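(* Let $r=r(t)$ be a normalization function and let $\mu^r(t)\in\mathcal{H}_{q,n}$ be a solution to the $r$-normalized bracket flow $\frac{d}{dt}\mu^r=-\pi\left(\begin{bmatrix}0&0\\0&\mathrm{Ric}_{\mu^r}+rI\end{bmatrix}\right)\mu^r$, $\mu^r(0)=\mu_0\in\mathcal{H}_{q,n}$. Write $\mathrm{Ric}=\mathrm{Ric}_{\mu^r(t)}$, $\mathrm{M}=\mathrm{M}_{\mu^r_{\mathfrak{p}}(t)}$, $B=B_{\mu^r(t)}$, $H=H_{\mu^r_{\mathfrak{p}}(t)}$, $U=S(\mathrm{ad}_{\mu^r_{\mathfrak{p}}(t)}H)$, $R=\mathrm{tr}\,\mathrm{Ric}$, $\Delta=\Delta_{\mu^r_{\mathfrak{p}}(t)}$. Then the following evolution equations hold: (i) $\frac{d}{dt}\mathrm{Ric}=-\frac12\Delta(\mathrm{Ric})-\frac12(B\,\mathrm{Ric}+\mathrm{Ric}\,B)-2S(\mathrm{ad}_{\mu^r_{\mathfrak{p}}}\mathrm{Ric}(H))-S([\mathrm{ad}_{\mu^r_{\mathfrak{p}}}H,\mathrm{Ric}])+2r\,\mathrm{Ric}$. (ii) $\frac{d}{dt}\mathrm{M}=-\frac12\Delta(\mathrm{Ric})+2r\mathrm{M}$. (iii) $\frac{d}{dt}B=B\,\mathrm{Ric}+\mathrm{Ric}\,B+2rB$. (iv) $\frac{d}{dt}H=\mathrm{Ric}(H)+rH$. (v) $\frac{d}{dt}U=2S(\mathrm{ad}_{\mu^r_{\mathfrak{p}}}\mathrm{Ric}(H))+S([\mathrm{ad}_{\mu^r_{\mathfrak{p}}}H,\mathrm{Ric}])+2rS(\mathrm{ad}_{\mu^r_{\mathfrak{p}}}H)$.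 (vi) $\frac{d}{dt}R=2\,\mathrm{tr}\,\mathrm{Ric}^2+2rR=2\|\mathrm{Ric}\|^2+2rR$. (vii) $\frac{d}{dt}\|\mu^r_{\mathfrak{p}}\|^2=-8\,\mathrm{tr}(\mathrm{Ric}\,\mathrm{M})+2r\|\mu^r_{\mathfrak{p}}\|^2$. (viii) $\frac{d}{dt}\mathrm{tr}\,B=2\,\mathrm{tr}(\mathrm{Ric}\,B)+2r\,\mathrm{tr}\,B$. (ix) $\frac{d}{dt}\|H\|^2=-2\,\mathrm{tr}\big(S(\mathrm{ad}_{\mu^r_{\mathfrak{p}}}H)^2\big)+2r\|H\|^2$.
   Context: Fix a real vector space $\mathfrak{g}=\mathfrak{k}\oplus\mathfrak{p}$ with $\dim\mathfrak{k}=q$, $\dim\mathfrak{p}=n$, and an inner product $\langle\cdot,\cdot\rangle$ on $\mathfrak{p}$ with orthonormal basis $\{X_1,\dots,X_n\}$. $V_{q+n}$ (resp. $V_n$) is the space of skew-symmetric bilinear maps $\mathfrak{g}\times\mathfrak{g}\to\mathfrak{g}$ (resp. $\mathfrak{p}\times\mathfrak{p}\to\mathfrak{p}$); $\mathrm{ad}_\mu X(Y)=\mu(X,Y)$; $\pi(A)\mu=A\mu(\cdot,\cdot)-\mu(A\cdot,\cdot)-\mu(\cdot,A\cdot)$, both for $A\in\mathfrak{gl}(\mathfrak{g})$, $\mu\in V_{q+n}$ and for $A\in\mathfrak{gl}(\mathfrak{p})=\mathfrak{gl}_n(\mathbb{R})$, $\mu\in V_n$. $\mathcal{H}_{q,n}\subset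 V_{q+n}$ is the set of $\mu$ such that: (h1) $\mu$ satisfies the Jacobi identity, $\mu(\mathfrak{k},\mathfrak{k})\subset\mathfrak{k}$ and $\mu(\mathfrak{k},\mathfrak{p})\subset\mathfrak{p}$; (h2) if $G_\mu$ is the simply connected Lie group with Lie algebra $(\mathfrak{g},\mu)$ and $K_\mu$ is the connected Lie subgroup with Lie algebra $\mathfrak{k}$, then $K_\mu$ is closed in $G_\mu$; (h3) $\mathrm{ad}_\mu Z|_{\mathfrak{p}}$ is skew-symmetric for all $Z\in\mathfrak{k}$; (h4) $\{Z\in\mathfrak{k}:\mu(Z,\mathfrak{p})=0\}=0$. Such a $\mu$ corresponds to the homogeneous space $(G_\mu/K_\mu,g_\mu)$, where $g_\mu$ is the $G_\mu$-invariant metric equal to $\langle\cdot,\cdot\rangle$ at the origin. For $\mu\in\mathcal{H}_{q,n}$, $\mu_{\mathfrak{p}}\in V_n$ is the $\mathfrak{p}$-component of $\mu|_{\mathfrak{p}\times\mathfrak{p}}$. $S(A)=\frac12(A+A^t)$ for $A\in\mathfrak{gl}_n(\mathbb{R})$. $B_\mu:\mathfrak{p}\to\mathfrak{p}$ is given by $\langle B_\mu X,Y\rangle=\mathrm{tr}(\mathrm{ad}_\mu X\,\mathrm{ad}_\mu Y)$ (trace over $\mathfrak{g}$), $X,Y\in\mathfrak{p}$. For $\lambda\in V_n$: $H_\lambda\in\mathfrak{p}$ is given by $\langle H_\lambda,X\rangle=\mathrm{tr}\,\mathrm{ad}_\lambda X$, and $\mathrm{M}_\lambda:\mathfrak{p}\to\mathfrak{p}$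 by $\langle\mathrm{M}_\lambda X,Y\rangle=-\frac12\sum_{i,j}\langle\lambda(X,X_i),X_j\rangle\langle\lambda(Y,X_i),X_j\rangle+\frac14\sum_{i,j}\langle\lambda(X_i,X_j),X\rangle\langle\lambda(X_i,X_j),Y\rangle$. The Ricci operator of $(G_\mu/K_\mu,g_\mu)$ is $\mathrm{Ric}_\mu=\mathrm{M}_{\mu_{\mathfrak{p}}}-\frac12B_\mu-S(\mathrm{ad}_{\mu_{\mathfrak{p}}}H_{\mu_{\mathfrak{p}}})$. A normalization function is a continuous real function $r(t)$ of time (which may depend on the solution itself). The inner product on $V_n$ is $\langle\mu,\lambda\rangle=\sum_{i,j}\langle\mu(X_i,X_j),\lambda(X_i,X_j)\rangle$ and on $\mathfrak{gl}_n(\mathbb{R})$ it is $\langle A,C\rangle=\mathrm{tr}(AC^t)$. For $\lambda\in V_n$, $\delta_\lambda:\mathfrak{gl}_n(\mathbb{R})\to V_n$ is $\delta_\lambda(E)=-\pi(E)\lambda$, $\delta_\lambda^t$ is its transpose, and $\Delta_\lambda:=S\circ\delta_\lambda^t\delta_\lambda:\mathfrak{gl}_n(\mathbb{R})\to\mathfrak{gl}_n(\mathbb{R})$. *)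

(* Defs.v *)
From HB Require Import structures.
From mathcomp Require Import all_boot all_order all_algebra.
From mathcomp Require Import ring.
From mathcomp Require Import all_classical all_reals all_analysis.

Set Implicit Arguments.
Unset Strict Implicit.
Unset Printing Implicit Defensive.

Import Order.TTheory GRing.Theory Num.Theory.
Import numFieldNormedType.Exports.

Local Open Scope classical_set_scope.
Local Open Scope ring_scope.

Section Smooth.
Context {R : realType}.

(* For V finite-dimensional and U open, this is the usual class C^k: all
   iterated directional derivatives up to order k exist and are continuous. *)
Fixpoint Ck {V W : normedModType R} (k : nat) (U : set V) (f : V -> W) : Prop :=
  match k with
  | 0 => forall x, U x -> {for x, continuous f}
  | k'.+1 => (forall x, U x -> differentiable f x) /\
             (forall v : V, Ck k' U (fun x => 'D_v f x))
  end.

Definition smooth_on {V W : normedModType R} (U : set V) (f : V -> W) : Prop :=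
  forall k, Ck k U f.

Record chart (M : topologicalType) (E : normedModType R) := Chart {
  chart_dom : set M;
  chart_map :> M -> E;
  chart_inv : E -> M }.

Record is_chart (M : topologicalType) (E : normedModType R) (c : chart M E) :
    Prop := IsChart {
  chart_dom_open : open (chart_dom c);
  chart_img_open : open (c @` chart_dom c);
  chart_mapK : forall x, chart_dom c x -> chart_inv c (c x) = x;
  chart_map_continuous : {within chart_dom c, continuous c};
  chart_inv_continuous : {within c @` chart_dom c, continuous (chart_inv c)} }.

Definition smooth_map {M N : topologicalType} {E F : normedModType R}
    (A : set (chart M E)) (B : set (chart N F)) (f : M -> N) : Prop :=
  continuous f /\
  forall c d, A c -> B d ->
    smooth_on (c @` (chart_dom c `&` f @^-1` chart_dom d))
              (fun x => d (f (chart_inv c x))).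

(* The last clause says that the transition maps are smooth. *)
Definition smooth_atlas {M : topologicalType} {E : normedModType R}
    (A : set (chart M E)) : Prop :=
  [/\ forall c, A c -> is_chart c,
      forall x, exists2 c, A c & chart_dom c x &
      smooth_map A A idfun].

Definition prod_chart {M N : topologicalType} {E F : normedModType R}
    (c : chart M E) (d : chart N F) : chart (M * N)%type (E * F)%type :=
  Chart (chart_dom c `*` chart_dom d)
        (fun p => (c p.1, d p.2))
        (fun p => (chart_inv c p.1, chart_inv d p.2)).

Definition prod_atlas {M N : topologicalType} {E F : normedModType R}
    (A : set (chart M E)) (B : set (chart N F)) :
    set (chart (M * N)%type (E * F)%type) :=
  [set e | exists c d, [/\ A c, B d & e = prod_chart c d]].

Definition simply_connected (M : topologicalType) : Prop :=
  (forall x y : M, exists g : R -> M,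
     [/\ {within `[0, 1], continuous g}, g 0 = x & g 1 = y]) /\
  (forall g : R -> M, {within `[0, 1], continuous g} -> g 0 = g 1 ->
     exists h : R * R -> M,
       [/\ {within [set` `[0, 1]] `*` [set` `[0, 1]], continuous h},
           forall s, (0 <= s <= 1) -> h (0, s) = g s,
           forall s, (0 <= s <= 1) -> h (1, s) = g 0 &
           forall t, (0 <= t <= 1) -> h (t, 0) = g 0 /\ h (t, 1) = g 0]).

End Smooth.

HB.mixin Record isTopologicalGroup G of Group G & Topological G := {
  mulg_continuous : continuous (fun p : G * G => (p.1 * p.2)%g);
  invg_continuous : continuous (fun x : G => x^-1%g) }.

#[short(type="topologicalGroupType")]
HB.structure Definition TopologicalGroup :=
  {G of isTopologicalGroup G & Group G & Topological G}.

Section LieGroups.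
Context {R : realType}.

Record is_lie_group (m : nat) (G : topologicalGroupType)
    (A : set (chart G 'cV[R]_m)) : Prop := IsLieGroup {
  lie_hausdorff : hausdorff_space G;
  lie_second_countable : @second_countable G;
  lie_atlas : smooth_atlas A;
  lie_mul_smooth :
    smooth_map (prod_atlas A A) A (fun p : G * G => (p.1 * p.2)%g);
  lie_inv_smooth : smooth_map A A (fun x : G => x^-1%g) }.

(* A chart c around the identity identifies the tangent space at 1 with
   'cV_m; left_field c v is, in this chart, the left-invariant vector field
   with value v at the identity. *)
Definition left_field m (G : topologicalGroupType) (c : chart G 'cV[R]_m)
    (v x : 'cV[R]_m) : 'cV[R]_m :=
  'D_v (fun y => c (chart_inv c x * chart_inv c y)%g) (c 1%g).

(* Commutator of left-invariant vector fields, [U,V] = DV(U) - DU(V) in a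
   chart, evaluated at the identity. *)
Definition lie_bracket m (G : topologicalGroupType) (c : chart G 'cV[R]_m)
    (u v : 'cV[R]_m) : 'cV[R]_m :=
  'D_u (left_field c v) (c 1%g) - 'D_v (left_field c u) (c 1%g).

(* L, read in the chart c, is an isomorphism from ('cV_m, mu) onto the Lie
   algebra of G. *)
Definition lie_algebra_iso m (G : topologicalGroupType)
    (A : set (chart G 'cV[R]_m)) (mu : 'cV[R]_m -> 'cV[R]_m -> 'cV[R]_m)
    (c : chart G 'cV[R]_m) (L : 'M[R]_m) : Prop :=
  [/\ A c, chart_dom c 1%g, L \in unitmx &
      forall X Y, L *m mu X Y = lie_bracket c (L *m X) (L *m Y)].

(* K is the connected (immersed) Lie subgroup of G whose Lie algebra is h,
   a subspace of the tangent space at 1 read in the chart c.  A morphism of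
   Lie groups is an immersion as soon as it is one at the identity. *)
Definition connected_lie_subgroup m (G : topologicalGroupType)
    (A : set (chart G 'cV[R]_m)) (c : chart G 'cV[R]_m)
    (h : set 'cV[R]_m) (K : set G) : Prop :=
  exists (p : nat) (G' : topologicalGroupType) (A' : set (chart G' 'cV[R]_p))
         (c' : chart G' 'cV[R]_p) (iota : G' -> G),
    let d_iota := 'd (fun x => c (iota (chart_inv c' x))) (c' 1%g) in
    [/\ is_lie_group A', connected [set: G'], A' c' & chart_dom c' 1%g] /\
    [/\ {morph iota : x y / (x * y)%g}, injective iota, smooth_map A' A iota &
        range iota = K] /\
    injective d_iota /\ range d_iota = h.

End LieGroups.

(* Coordinates are taken with respect to a basis of k and the orthonormal
   basis {X_1, ..., X_n} of p, so that k = 'cV_q, p = 'cV_n with its standard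
   inner product, and g = 'cV_(q + n); matrices act on column vectors. *)

Section Brackets.
Context {R : realType}.

Definition dotv n (X Y : 'cV[R]_n) : R := \sum_i X i 0 * Y i 0.

(* V_n is the set of elements of bracket n satisfying skew_bilinear. *)
Definition bracket n := 'cV[R]_n -> 'cV[R]_n -> 'cV[R]_n.

Definition skew_bilinear n (mu : bracket n) : Prop :=
  (forall X, linear (mu X)) /\ (forall X Y, mu X Y = - mu Y X).

Definition basisv n (i : 'I_n) : 'cV[R]_n := delta_mx i 0.

Definition ad n (mu : bracket n) (X : 'cV[R]_n) : 'M[R]_n :=
  \matrix_(i, j) mu X (basisv j) i 0.

Definition pi_act n (A : 'M[R]_n) (mu : bracket n) : bracket n :=
  fun X Y => A *m mu X Y - mu (A *m X) Y - mu X (A *m Y).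

Definition symm n (A : 'M[R]_n) : 'M[R]_n := 2^-1 *: (A + A^T).

Definition commm n (A C : 'M[R]_n) : 'M[R]_n := A *m C - C *m A.

(* The vector v with <v, X> = l X, for l linear. *)
Definition vec_of_form n (l : 'cV[R]_n -> R) : 'cV[R]_n :=
  \col_i l (basisv i).

(* The operator T with <T X, Y> = b X Y, for b bilinear. *)
Definition op_of_form n (b : 'cV[R]_n -> 'cV[R]_n -> R) : 'M[R]_n :=
  \matrix_(i, j) b (basisv j) (basisv i).

Definition Hvec n (la : bracket n) : 'cV[R]_n :=
  vec_of_form (fun X => \tr (ad la X)).

Definition Mform n (la : bracket n) (X Y : 'cV[R]_n) : R :=
  - 2^-1 * (\sum_i \sum_j dotv (la X (basisv i)) (basisv j)
                        * dotv (la Y (basisv i)) (basisv j))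
  + 4^-1 * (\sum_i \sum_j dotv (la (basisv i) (basisv j)) X
                        * dotv (la (basisv i) (basisv j)) Y).

Definition Mop n (la : bracket n) : 'M[R]_n := op_of_form (Mform la).

Definition dot_bracket n (mu la : bracket n) : R :=
  \sum_i \sum_j dotv (mu (basisv i) (basisv j)) (la (basisv i) (basisv j)).

Definition dotm n (A C : 'M[R]_n) : R := \tr (A *m C^T).

Definition delta n (la : bracket n) (E : 'M[R]_n) : bracket n :=
  fun X Y => - pi_act E la X Y.

(* The transpose of delta la, read off on the orthonormal basis of matrix
   units; see dotm_delta_tr below. *)
Definition delta_tr n (la nu : bracket n) : 'M[R]_n :=
  \matrix_(i, j) dot_bracket nu (delta la (delta_mx i j)).

Definition Delta n (la : bracket n) (E : 'M[R]_n) : 'M[R]_n :=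
  symm (delta_tr la (delta la E)).

Section Reductive.
Variables q n : nat.
Implicit Types (mu : bracket (q + n)).

Definition in_k (Z : 'cV[R]_q) : 'cV[R]_(q + n) := col_mx Z 0.
Definition in_p (X : 'cV[R]_n) : 'cV[R]_(q + n) := col_mx 0 X.

Definition proj_p mu : bracket n := fun X Y => dsubmx (mu (in_p X) (in_p Y)).

Definition Bop mu : 'M[R]_n :=
  op_of_form (fun X Y => \tr (ad mu (in_p X) *m ad mu (in_p Y))).

Definition Uop mu : 'M[R]_n := symm (ad (proj_p mu) (Hvec (proj_p mu))).

Definition Ric mu : 'M[R]_n := Mop (proj_p mu) - 2^-1 *: Bop mu - Uop mu.

Definition jacobi mu : Prop := forall X Y Z,
  mu X (mu Y Z) + mu Y (mu Z X) + mu Z (mu X Y) = 0.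

(* A simply connected Lie group with Lie algebra (g, mu) exists and is unique
   up to isomorphism, so quantifying over all of them is the same as fixing
   one, G_mu; likewise for its connected Lie subgroup K_mu. *)
Definition closed_isotropy mu : Prop :=
  forall (G : topologicalGroupType) (A : set (chart G 'cV[R]_(q + n)))
         (c : chart G 'cV[R]_(q + n)) (L : 'M[R]_(q + n)),
    is_lie_group A -> simply_connected (R := R) G -> lie_algebra_iso A mu c L ->
    forall K : set G,
      connected_lie_subgroup A c (range (fun Z => L *m in_k Z)) K -> closed K.

Record homogeneous mu : Prop := Homogeneous {
  hom_skew_bilinear : skew_bilinear mu;
  hom_jacobi : jacobi mu;
  hom_kk : forall Z W, dsubmx (mu (in_k Z) (in_k W)) = 0;
  hom_kp : forall Z X, usubmx (mu (in_k Z) (in_p X)) = 0;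
  hom_closed : closed_isotropy mu;
  hom_skew : forall Z,
    (drsubmx (ad mu (in_k Z)))^T = - drsubmx (ad mu (in_k Z));
  hom_effective : forall Z, (forall X, mu (in_k Z) (in_p X) = 0) -> Z = 0 }.

(* The derivative of a curve in the finite-dimensional space V_{q+n} is taken
   pointwise. *)
Definition normalized_bracket_flow (J : set R) (r : R -> R)
    (mu : R -> bracket (q + n)) : Prop :=
  forall t, J t -> forall X Y,
    is_derive t 1 (fun s => mu s X Y)
      (- pi_act (block_mx 0 0 0 (Ric (mu t) + (r t)%:M)) (mu t) X Y).

End Reductive.

Lemma cV_basis n (X : 'cV[R]_n) : X = \sum_i X i 0 *: basisv i.
Proof. by rewrite {1}(matrix_sum_delta X); apply: eq_bigr => i _; rewrite big_ord1. Qed.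

Lemma scalar_formE n (l : 'cV[R]_n -> R) (X : 'cV[R]_n) :
  (forall a u v, l (a *: u + v) = a * l u + l v) ->
  l X = \sum_i X i 0 * l (basisv i).
Proof.
move=> lin.
have l0 : l 0 = 0.
  have := lin 1 0 0; rewrite scale1r addr0 mul1r => /eqP.
  by rewrite -subr_eq0 opprD addrA subrr sub0r oppr_eq0 => /eqP.
have lD u v : l (u + v) = l u + l v by rewrite -[u]scale1r lin mul1r scale1r.
rewrite {1}(cV_basis X) (big_morph l lD l0); apply: eq_bigr => i _.
by rewrite -[X in l X]addr0 lin l0 addr0.
Qed.

Lemma ad_mulmx n (mu : bracket n) X Y :
  skew_bilinear mu -> ad mu X *m Y = mu X Y.
Proof.
case=> lin _; apply/matrixP => i j; rewrite ord1 !mxE.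
rewrite (scalar_formE (l := fun Y => mu X Y i 0)).
  by apply: eq_bigr => k _; rewrite mxE mulrC.
by move=> a u v; rewrite lin !mxE.
Qed.

Lemma dotv_vec_of_form n (l : 'cV[R]_n -> R) (X : 'cV[R]_n) :
  (forall a u v, l (a *: u + v) = a * l u + l v) ->
  dotv (vec_of_form l) X = l X.
Proof.
by move=> lin; rewrite (scalar_formE X lin); apply: eq_bigr => i _; rewrite mxE mulrC.
Qed.

Lemma dotv_op_of_form n (b : 'cV[R]_n -> 'cV[R]_n -> R) (X Y : 'cV[R]_n) :
  (forall Z a u v, b (a *: u + v) Z = a * b u Z + b v Z) ->
  (forall Z a u v, b Z (a *: u + v) = a * b Z u + b Z v) ->
  dotv (op_of_form b *m X) Y = b X Y.
Proof.
move=> linl linr; rewrite (scalar_formE Y (linr X)).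
apply: eq_bigr => i _; rewrite mxE mulrC; congr (_ * _).
rewrite (scalar_formE (l := fun X => b X (basisv i)) X) //.
by apply: eq_bigr => j _; rewrite mxE mulrC.
Qed.

Lemma pi_act_linear n (la : bracket n) a E F X Y : skew_bilinear la ->
  pi_act (a *: E + F) la X Y = a *: pi_act E la X Y + pi_act F la X Y.
Proof.
case=> lin skew; rewrite /pi_act !mulmxDl -!scalemxAl lin.
have -> : la (a *: (E *m X) + F *m X) Y = a *: la (E *m X) Y + la (F *m X) Y.
  by rewrite skew lin (skew Y) (skew Y (F *m X)) opprD scalerN !opprK.
by apply/matrixP => i j; rewrite !mxE !mulrDr !mulrN !opprD !addrA; ring.
Qed.

Lemma dotm_delta_tr n (la nu : bracket n) (E : 'M[R]_n) : skew_bilinear la ->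
  dotm (delta_tr la nu) E = dot_bracket nu (delta la E).
Proof.
move=> sb; pose f E := dot_bracket nu (delta la E).
have flin a F1 F2 : f (a *: F1 + F2) = a * f F1 + f F2.
  rewrite /f /dot_bracket mulr_sumr -big_split; apply: eq_bigr => i _ /=.
  rewrite mulr_sumr -big_split; apply: eq_bigr => j _ /=.
  rewrite /dotv mulr_sumr -big_split; apply: eq_bigr => k _ /=.
  by rewrite /delta pi_act_linear // !mxE; ring.
have f0 : f 0 = 0.
  have := flin 1 0 0; rewrite scale1r addr0 mul1r => /eqP.
  by rewrite -subr_eq0 opprD addrA subrr sub0r oppr_eq0 => /eqP.
have fD F1 F2 : f (F1 + F2) = f F1 + f F2.
  by rewrite -[F1]scale1r flin mul1r scale1r.
rewrite -/(f E) [in RHS](matrix_sum_delta E) (big_morph f fD f0).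
apply: eq_bigr => i _; rewrite mxE (big_morph f fD f0).
apply: eq_bigr => j _; rewrite !mxE -[X in f X]addr0 flin f0 addr0.
by rewrite mulrC.
Qed.

End Brackets.

Arguments bracket : clear implicits.

(* Main.v *)
(* Put E = Ric + r I.  The flow reads mu' = [delta mu (0 + E)], so that
   ad_mu'(X) = [ad_mu X, E] + ad_mu(E X) and likewise for la = mu_p; this gives
   the evolution of H, U and B, the commutators dropping out of the traces.
   For M one differentiates the polar form of tr(M_la A) = 1/4 <pi(A) la, la>.

   The equations for R and |H|^2 need <Ric H, H> = tr(Ric U) = - tr U^2, which
   uses the Jacobi identity.  The isotropy algebra is unimodular, since it acts
   faithfully by skew maps; as tr ad_mu vanishes on brackets, H is orthogonal to
   la(p, p) and killed by k.  This gives <Ric H, H>.  Next, ad_mu H is a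
   derivation mapping p to k + p, with k-component a, say.  As k and p need not
   be Killing-orthogonal, neither tr(M ad_la H) nor tr(B ad_la H) need vanish,
   but both are multiples of the sum over i of tr(ad(a X_i)|_p ad_la X_i), and
   these contributions cancel in tr((M - B/2) ad_la H). *)
Require Import Defs.
From HB Require Import structures.
From mathcomp Require Import all_boot all_order all_algebra.
From mathcomp Require Import ring.
From mathcomp Require Import all_classical all_reals all_analysis.
Import Order.TTheory GRing.Theory Num.Theory.
Import numFieldNormedType.Exports.
Local Open Scope classical_set_scope.
Local Open Scope ring_scope.

Set Implicit Arguments.
Unset Strict Implicit.
Unset Printing Implicit Defensive.

(** * Differentiation rules for curves of vectors and matrices *)

Section Calculus.
Context {R : realType}.
Implicit Type t : R.

(** Reduces every matrix-valued derivative below to scalar curves, where the sum and product rules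
    apply. *)
Lemma is_derive_mxP m p (F : R -> 'M[R]_(m, p)) t D :
  is_derive t 1 F D <-> forall i j, is_derive t 1 (fun s => F s i j) (D i j).
Proof.
split=> [[Fd FD] i j|FD].
  apply: DeriveDef; first exact: (iffLR (derivable_mxP _ _ _) Fd).
  by rewrite -FD (derive_mx Fd) mxE.
have Fd : derivable F t 1 by apply/derivable_mxP => i j; have [] := FD i j.
apply: DeriveDef => //; rewrite (derive_mx Fd); apply/matrixP => i j.
by rewrite mxE; have [] := FD i j.
Qed.

Lemma is_derive_mul (f g : R -> R) t (df dg : R) :
  is_derive t 1 f df -> is_derive t 1 g dg ->
  is_derive t 1 (fun s => f s * g s) (df * g t + f t * dg).
Proof.
move=> fd gd; apply: (is_derive_eq (is_deriveM fd gd)).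
by rewrite addrC; congr (_ + _); exact: mulrC.
Qed.

Lemma is_derive_bigsum (V : normedModType R) n (F : 'I_n -> R -> V) t
    (D : 'I_n -> V) :
  (forall i, is_derive t 1 (F i) (D i)) ->
  is_derive t 1 (fun s => \sum_i F i s) (\sum_i D i).
Proof.
move=> FD; have := is_derive_sum FD; congr is_derive.
by apply/funext => s; rewrite fct_sumE.
Qed.

Lemma is_derive_add (V : normedModType R) (F G : R -> V) t (dF dG : V) :
  is_derive t 1 F dF -> is_derive t 1 G dG ->
  is_derive t 1 (fun s => F s + G s) (dF + dG).
Proof. exact: is_deriveD. Qed.

Lemma is_derive_sub (V : normedModType R) (F G : R -> V) t (dF dG : V) :
  is_derive t 1 F dF -> is_derive t 1 G dG ->
  is_derive t 1 (fun s => F s - G s) (dF - dG).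
Proof. exact: is_deriveB. Qed.

Lemma is_derive_scale (V : normedModType R) (a : R) (F : R -> V) t (dF : V) :
  is_derive t 1 F dF -> is_derive t 1 (fun s => a *: F s) (a *: dF).
Proof. exact: is_deriveZ. Qed.

Lemma is_derive_mulmx m p k (A : R -> 'M[R]_(m, p)) (C : R -> 'M[R]_(p, k))
    t dA dC :
  is_derive t 1 A dA -> is_derive t 1 C dC ->
  is_derive t 1 (fun s => A s *m C s) (dA *m C t + A t *m dC).
Proof.
move=> /is_derive_mxP Ad /is_derive_mxP Cd; apply/is_derive_mxP => i j.
rewrite !mxE -big_split.
under [fun s => _]eq_fun do rewrite mxE.
by apply: is_derive_bigsum => l; exact: is_derive_mul.
Qed.

Lemma is_derive_tr n (A : R -> 'M[R]_n) t dA :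
  is_derive t 1 A dA -> is_derive t 1 (fun s => \tr (A s)) (\tr dA).
Proof. by move/is_derive_mxP => Ad; exact: is_derive_bigsum. Qed.

Lemma is_derive_trmx m p (A : R -> 'M[R]_(m, p)) t dA :
  is_derive t 1 A dA -> is_derive t 1 (fun s => (A s)^T) dA^T.
Proof.
move/is_derive_mxP => Ad; apply/is_derive_mxP => i j; rewrite mxE.
by under [fun s => _]eq_fun do rewrite mxE.
Qed.

Lemma is_derive_symm n (A : R -> 'M[R]_n) t dA :
  is_derive t 1 A dA -> is_derive t 1 (fun s => symm (A s)) (symm dA).
Proof.
move=> Ad; apply: is_derive_scale; apply: is_derive_add => //.
exact: is_derive_trmx.
Qed.

Lemma is_derive_dotv n (X Y : R -> 'cV[R]_n) t dX dY :
  is_derive t 1 X dX -> is_derive t 1 Y dY ->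
  is_derive t 1 (fun s => dotv (X s) (Y s)) (dotv dX (Y t) + dotv (X t) dY).
Proof.
move=> /is_derive_mxP Xd /is_derive_mxP Yd; rewrite /dotv -big_split.
by apply: is_derive_bigsum => l; exact: is_derive_mul.
Qed.

End Calculus.

(** * Inner products, traces, brackets and the polarized moment map on p *)

Section Bilinear.
Context {R : realType} {n : nat}.
Implicit Types (la nu : bracket R n) (E A C : 'M[R]_n) (X Y Z : 'cV[R]_n).

Lemma dotvC X Y : dotv X Y = dotv Y X.
Proof. by apply: eq_bigr => i _; rewrite mulrC. Qed.

Lemma dotv_linear Z a X Y : dotv (a *: X + Y) Z = a * dotv X Z + dotv Y Z.
Proof.
rewrite /dotv mulr_sumr -big_split; apply: eq_bigr => i _ /=.
by rewrite !mxE; ring.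
Qed.

Lemma dotvDl X Y Z : dotv (X + Y) Z = dotv X Z + dotv Y Z.
Proof. by rewrite -[X]scale1r dotv_linear mul1r scale1r. Qed.

Lemma dotv0 Z : dotv 0 Z = 0.
Proof. by rewrite /dotv big1 // => i _; rewrite mxE mul0r. Qed.

Lemma dotvZl a X Z : dotv (a *: X) Z = a * dotv X Z.
Proof. by rewrite -[a *: X]addr0 dotv_linear dotv0 addr0. Qed.

Lemma dotvNl X Z : dotv (- X) Z = - dotv X Z.
Proof. by rewrite -scaleN1r dotvZl mulN1r. Qed.

Lemma dotvBl X Y Z : dotv (X - Y) Z = dotv X Z - dotv Y Z.
Proof. by rewrite dotvDl dotvNl. Qed.

Lemma dotvNr X Z : dotv Z (- X) = - dotv Z X.
Proof. by rewrite !(dotvC Z) dotvNl. Qed.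

Lemma dotv_mx X Y : dotv X Y = (X^T *m Y) 0 0.
Proof. by rewrite mxE; apply: eq_bigr => i _; rewrite mxE. Qed.

Lemma dotv_mulmxl A X Y : dotv (A *m X) Y = dotv X (A^T *m Y).
Proof. by rewrite !dotv_mx trmx_mul mulmxA. Qed.

Lemma dotv_basis X i : dotv X (basisv i) = X i 0.
Proof.
rewrite /dotv (bigD1 i) //= mxE !eqxx mulr1 big1 ?addr0 // => j /negPf ji.
by rewrite mxE ji mulr0.
Qed.

Lemma dotv_eq0 X : (forall Y, dotv X Y = 0) -> X = 0.
Proof.
by move=> X0; apply/matrixP => i j; rewrite ord1 -dotv_basis X0 mxE.
Qed.

Lemma mulmx_basis m (A : 'M[R]_(m, n)) i : A *m basisv i = col i A.
Proof. by rewrite colE. Qed.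

Lemma eq_mulmx_basis m (A C : 'M[R]_(m, n)) :
  (forall j, A *m basisv j = C *m basisv j) -> A = C.
Proof.
move=> AC; apply/matrixP => i j; have := AC j; rewrite !mulmx_basis.
by move/matrixP/(_ i 0); rewrite !mxE.
Qed.

(** Expansion of [Y] in the orthonormal basis; it removes one summation index when the trace of the
    moment map is computed. *)
Lemma sum_dotv_basis A X Y :
  \sum_i dotv X (A *m basisv i) * dotv Y (basisv i) = dotv X (A *m Y).
Proof.
rewrite {2}(cV_basis Y) linear_sum /= dotvC.
rewrite (big_morph (fun Z => dotv Z X) (fun u v => dotvDl u v X) (dotv0 X)).
apply: eq_bigr => i _.
by rewrite dotv_basis -scalemxAr dotvZl mulrC dotvC.
Qed.

Lemma dotv_parseval X Y :
  \sum_i dotv X (basisv i) * dotv Y (basisv i) = dotv X Y.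
Proof.
rewrite -[in RHS](mul1mx Y) -sum_dotv_basis.
by apply: eq_bigr => i _; rewrite mul1mx.
Qed.

Lemma sum_dotv_mulmx A C :
  \sum_i dotv (A *m basisv i) (C *m basisv i) = \tr (A^T *m C).
Proof.
apply: eq_bigr => i _.
by rewrite dotv_mulmxl mulmxA mulmx_basis dotvC dotv_basis [LHS]mxE.
Qed.

Lemma trmx_symm A : (symm A)^T = symm A.
Proof.
by rewrite /symm [LHS]linearZ /= [(A + A^T)^T]linearD /= trmxK addrC.
Qed.

Lemma symm_trmx A : symm A^T = symm A.
Proof. by rewrite /symm trmxK addrC. Qed.

Lemma symmD A C : symm (A + C) = symm A + symm C.
Proof. by rewrite /symm [(A + C)^T]linearD addrACA scalerDr. Qed.

Lemma symmZ a A : symm (a *: A) = a *: symm A.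
Proof. by rewrite /symm [(a *: A)^T]linearZ -scalerDr !scalerA mulrC. Qed.

Lemma tr_symm A : \tr (symm A) = \tr A.
Proof.
rewrite /symm mxtraceZ mxtraceD mxtrace_tr.
by field.
Qed.

(** The skew part of [C] is trace-orthogonal to the symmetric matrix [A]. *)
Lemma tr_mul_symm A C : A^T = A -> \tr (A *m symm C) = \tr (A *m C).
Proof.
move=> At; rewrite /symm -scalemxAr mulmxDr mxtraceZ mxtraceD.
rewrite -(mxtrace_tr (A *m C^T)) trmx_mul trmxK At (mxtrace_mulC C).
by field.
Qed.

Lemma mxtraceB A C : \tr (A - C) = \tr A - \tr C.
Proof. exact: linearB. Qed.

Lemma mxtraceN A : \tr (- A) = - \tr A.
Proof. exact: linearN. Qed.

Lemma mxtrace_commm A C : \tr (commm A C) = 0.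
Proof. by rewrite mxtraceB mxtrace_mulC subrr. Qed.

(** By the Leibniz rule the sum is the trace of [commm (A *m C) D]. *)
Lemma mxtrace_commm_ad A C D :
  \tr (commm A D *m C) + \tr (A *m commm C D) = 0.
Proof.
rewrite mulmxBl mulmxBr !mxtraceB !mulmxA -(mulmxA D) (mxtrace_mulC D).
by ring.
Qed.

Lemma mxtrace_commm_mul A C : \tr (commm A C *m C) = 0.
Proof.
rewrite mulmxBl mxtraceB -mulmxA mxtrace_mulC [X in _ - X]mxtrace_mulC mulmxA.
exact: subrr.
Qed.

Lemma mxtrace_op_of_form (b : 'cV[R]_n -> 'cV[R]_n -> R) E :
  (forall Z a u v, b (a *: u + v) Z = a * b u Z + b v Z) ->
  (forall Z a u v, b Z (a *: u + v) = a * b Z u + b Z v) ->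
  \tr (op_of_form b *m E) = \sum_i b (E *m basisv i) (basisv i).
Proof.
move=> bl br; apply: eq_bigr => i _.
by rewrite -(dotv_op_of_form _ _ bl br) dotv_basis mulmxA mulmx_basis [RHS]mxE.
Qed.

Lemma dotm_eq0 A : dotm A A = 0 -> A = 0.
Proof.
move=> A0; apply/matrixP => i j; rewrite [RHS]mxE.
apply/eqP; rewrite -sqrf_eq0; apply/eqP.
have s0 : \sum_k \sum_l A k l ^+ 2 = 0.
  rewrite -[RHS]A0; apply: eq_bigr => k _; rewrite mxE; apply: eq_bigr => l _.
  by rewrite mxE expr2.
have pos (k l : 'I_n) : 0 <= A k l ^+ 2 by rewrite sqr_ge0.
have row0 : \sum_l A i l ^+ 2 = 0.
  by apply: (psumr_eq0P _ s0) => // k _; apply: sumr_ge0 => l _; exact: pos.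
by apply: (psumr_eq0P _ row0) => // l _; exact: pos.
Qed.

Lemma dot_bracketC la nu : dot_bracket la nu = dot_bracket nu la.
Proof. by apply: eq_bigr => i _; apply: eq_bigr => j _; exact: dotvC. Qed.

Section Skew.
Variable la : bracket R n.
Hypothesis la_skew : skew_bilinear la.

Lemma bracketC X Y : la X Y = - la Y X.
Proof. by case: la_skew. Qed.

Lemma bracketPr Z a X Y : la Z (a *: X + Y) = a *: la Z X + la Z Y.
Proof. by case: la_skew => lin _; exact: lin. Qed.

Lemma bracketPl Z a X Y : la (a *: X + Y) Z = a *: la X Z + la Y Z.
Proof.
by rewrite bracketC bracketPr (bracketC X) (bracketC Y) opprD scalerN.
Qed.

Lemma bracketDr Z X Y : la Z (X + Y) = la Z X + la Z Y.
Proof. by rewrite -[X]scale1r bracketPr !scale1r. Qed.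

Lemma bracketDl Z X Y : la (X + Y) Z = la X Z + la Y Z.
Proof. by rewrite -[X]scale1r bracketPl !scale1r. Qed.

Lemma bracket0r X : la X 0 = 0.
Proof.
have /eqP := bracketDr X 0 0.
by rewrite addr0 -subr_eq0 opprD addNKr oppr_eq0 => /eqP.
Qed.

Lemma bracket0l X : la 0 X = 0.
Proof. by rewrite bracketC bracket0r oppr0. Qed.

Lemma bracketZr a X Y : la X (a *: Y) = a *: la X Y.
Proof. by rewrite -[a *: Y]addr0 bracketPr bracket0r addr0. Qed.

Lemma bracketZl a X Y : la (a *: X) Y = a *: la X Y.
Proof. by rewrite bracketC bracketZr -scalerN -bracketC. Qed.

Lemma bracketNr X Y : la X (- Y) = - la X Y.
Proof. by rewrite -scaleN1r bracketZr scaleN1r. Qed.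

Lemma ad_eq C X : (forall Y, la X Y = C *m Y) -> ad la X = C.
Proof.
by move=> XC; apply/matrixP => i j; rewrite mxE XC mulmx_basis mxE.
Qed.

Lemma adP a X Y : ad la (a *: X + Y) = a *: ad la X + ad la Y.
Proof. by apply/matrixP => i j; rewrite !mxE bracketPl !mxE. Qed.

Lemma adD X Y : ad la (X + Y) = ad la X + ad la Y.
Proof. by rewrite -[X]scale1r adP !scale1r. Qed.

Lemma ad0 : ad la 0 = 0.
Proof. by apply/matrixP => i j; rewrite !mxE bracket0l mxE. Qed.

Lemma adZ a X : ad la (a *: X) = a *: ad la X.
Proof. by rewrite -[_ *: X]addr0 adP ad0 addr0. Qed.

(** Separates the dependence on [X] from that on [la], so that [ad (la s) (Hvec (la s))] can be
    differentiated by a product rule. *)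
Lemma ad_sum X : ad la X = \sum_i X i 0 *: ad la (basisv i).
Proof.
rewrite {1}(cV_basis X) (big_morph (ad la) adD ad0).
by apply: eq_bigr => i _; exact: adZ.
Qed.

Lemma dotv_Hvec X : dotv (Hvec la) X = \tr (ad la X).
Proof.
by apply: dotv_vec_of_form => a u v; rewrite adP mxtraceD mxtraceZ.
Qed.

Lemma skew_bilinear_delta E : skew_bilinear (delta la E).
Proof.
split=> [X a Y Z|X Y].
  rewrite /delta /pi_act bracketPr mulmxDr -scalemxAr bracketPr.
  rewrite mulmxDr -scalemxAr bracketPr.
  by apply/matrixP => i j; rewrite !mxE; ring.
rewrite /delta /pi_act (bracketC Y) (bracketC (E *m Y)) (bracketC Y) mulmxN.
by apply/matrixP => i j; rewrite !mxE; ring.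
Qed.

Lemma ad_delta E X : ad (delta la E) X = commm (ad la X) E + ad la (E *m X).
Proof.
apply/matrixP => i j.
have -> : ad (delta la E) X i j = (- pi_act E la X (basisv j)) i 0.
  by rewrite mxE.
rewrite /pi_act -!(ad_mulmx _ _ la_skew) !mulmxA -!mulmxBl -mulNmx mulmx_basis.
by rewrite mxE !opprB addrCA addrC.
Qed.

Lemma Hvec_delta E : Hvec (delta la E) = E^T *m Hvec la.
Proof.
apply/matrixP => i j; rewrite ord1 mxE ad_delta mxtraceD mxtrace_commm.
rewrite add0r -dotv_Hvec dotvC dotv_mulmxl.
by rewrite dotvC dotv_basis.
Qed.

End Skew.

(* The polarization of [Mform], arranged so that its trace against E is
   [pi_act E la] paired with [nu] for every E, symmetric or not. *)
Definition Mpolar la nu X Y : R :=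
  - 2^-1 * (\sum_i \sum_j dotv (la X (basisv i)) (basisv j)
                        * dotv (nu Y (basisv i)) (basisv j))
  + 4^-1 * (\sum_i \sum_j dotv (nu (basisv i) (basisv j)) X
                        * dotv (la (basisv i) (basisv j)) Y).

Lemma MpolarC la nu X Y : Mpolar la nu X Y = Mpolar nu la Y X.
Proof.
by congr (_ * _ + _ * _); apply: eq_bigr => i _; apply: eq_bigr => j _;
  rewrite mulrC.
Qed.

Lemma Mpolar_linear la nu Z a X Y : skew_bilinear la ->
  Mpolar la nu (a *: X + Y) Z = a * Mpolar la nu X Z + Mpolar la nu Y Z.
Proof.
move=> las; rewrite /Mpolar mulrDr addrACA; congr (_ + _);
  rewrite mulrCA -mulrDr; congr (_ * _); rewrite mulr_sumr -big_split;
  apply: eq_bigr => i _; rewrite mulr_sumr -big_split; apply: eq_bigr => j _ /=.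
  by rewrite bracketPl // dotv_linear; ring.
by rewrite ![dotv (nu _ _) _]dotvC dotv_linear; ring.
Qed.

Lemma Mpolar_linearr la nu Z a X Y : skew_bilinear nu ->
  Mpolar la nu Z (a *: X + Y) = a * Mpolar la nu Z X + Mpolar la nu Z Y.
Proof. by move=> nus; rewrite !(MpolarC la) Mpolar_linear. Qed.

Lemma dotv_Mop la X Y : skew_bilinear la ->
  dotv (Mop la *m X) Y = Mpolar la la X Y.
Proof.
move=> las; apply: dotv_op_of_form => *.
  exact: Mpolar_linear.
exact: Mpolar_linearr.
Qed.

(** The moment map property of M, in polarized form: up to the factor 4, pairing with [E] gives the
    infinitesimal action of [E]. *)
Lemma mxtrace_Mpolar la nu E : skew_bilinear la -> skew_bilinear nu ->
  \tr (op_of_form (Mpolar la nu) *m E) = 4^-1 * dot_bracket (pi_act E la) nu.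
Proof.
move=> las nus; rewrite mxtrace_op_of_form; last 2 first.
- by move=> *; exact: Mpolar_linear.
- by move=> *; exact: Mpolar_linearr.
set T := \sum_i \sum_j dotv (la (E *m basisv i) (basisv j))
                            (nu (basisv i) (basisv j)).
set S := \sum_i \sum_j dotv (E *m la (basisv i) (basisv j))
                            (nu (basisv i) (basisv j)).
(* Of the three terms of [pi_act], the last equals [T]: exchanging the two indices costs one sign in
   [la] and one in [nu]. *)
have -> : dot_bracket (pi_act E la) nu = S - T - T.
  have -> : S - T - T = S - T - \sum_i \sum_j
      dotv (la (basisv i) (E *m basisv j)) (nu (basisv i) (basisv j)).
    rewrite exchange_big; congr (_ - _).
    apply: eq_bigr => i _; apply: eq_bigr => j _ /=.
    by rewrite (bracketC las) (bracketC nus) dotvNl dotvNr opprK.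
  rewrite -!sumrB; apply: eq_bigr => i _.
  rewrite -!sumrB; apply: eq_bigr => j _.
  by rewrite /pi_act !dotvBl.
rewrite big_split -!mulr_sumr /=.
have -> : \sum_i \sum_k \sum_j dotv (la (E *m basisv i) (basisv k)) (basisv j) *
     dotv (nu (basisv i) (basisv k)) (basisv j) = T.
  by apply: eq_bigr => i _; apply: eq_bigr => j _; exact: dotv_parseval.
have -> : \sum_k \sum_i \sum_j dotv (nu (basisv i) (basisv j)) (E *m basisv k) *
     dotv (la (basisv i) (basisv j)) (basisv k) = S.
  rewrite exchange_big; apply: eq_bigr => i _; rewrite exchange_big.
  apply: eq_bigr => j _; rewrite (sum_dotv_basis E).
  exact: dotvC.
by field.
Qed.

Lemma op_of_MpolarC la nu :
  op_of_form (Mpolar nu la) = (op_of_form (Mpolar la nu))^T.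
Proof. by apply/matrixP => i j; rewrite !mxE MpolarC. Qed.

Lemma mxtrace_Mop la E : skew_bilinear la ->
  \tr (Mop la *m E) = 4^-1 * dot_bracket (pi_act E la) la.
Proof. by move=> las; exact: mxtrace_Mpolar. Qed.

Lemma trmx_Mop la : (Mop la)^T = Mop la.
Proof. by rewrite -op_of_MpolarC. Qed.

Lemma dot_bracketNr la nu :
  dot_bracket la (fun X Y => - nu X Y) = - dot_bracket la nu.
Proof.
rewrite -sumrN; apply: eq_bigr => i _; rewrite -sumrN; apply: eq_bigr => j _.
exact: dotvNr.
Qed.

(** [mxtrace_Mpolar] applied to the matrix units. Hence [Delta] is a multiple of a symmetrized polar
    form, which is how it enters the evolution of M. *)
Lemma delta_trE la nu : skew_bilinear la -> skew_bilinear nu ->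
  delta_tr la nu = - 4 *: (op_of_form (Mpolar la nu))^T.
Proof.
move=> las nus; apply/matrixP => i j; rewrite mxE [RHS]mxE [X in _ * X]mxE.
have -> : op_of_form (Mpolar la nu) j i
    = \tr (op_of_form (Mpolar la nu) *m delta_mx i j).
  rewrite -(mul_delta_mx (0 : 'I_1)) mulmxA mxtrace_mulC -colE.
  by rewrite -rowE /mxtrace big_ord1 !mxE.
rewrite mxtrace_Mpolar // mulrA mulNr mulfV ?pnatr_eq0 // mulN1r.
by rewrite [in RHS]dot_bracketC -dot_bracketNr.
Qed.

Lemma dot_bracketP a la1 la2 nu :
  dot_bracket (fun X Y => a *: la1 X Y + la2 X Y) nu
  = a * dot_bracket la1 nu + dot_bracket la2 nu.
Proof.
rewrite mulr_sumr -big_split; apply: eq_bigr => i _ /=.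
rewrite mulr_sumr -big_split; apply: eq_bigr => j _ /=.
exact: dotv_linear.
Qed.

(** The trace is a pairing with the identity matrix, and [pi_act 1%:M la] is [- la]; what remains is
    the pairing of [pi_act E la] with [la], that is, the moment map again. *)
Lemma mxtrace_Delta la E : skew_bilinear la ->
  \tr (Delta la E) = - 4 * \tr (Mop la *m E).
Proof.
move=> las; have ds := skew_bilinear_delta las E.
rewrite tr_symm delta_trE // mxtraceZ mxtrace_tr -[op_of_form _]mulmx1.
rewrite mxtrace_Mpolar // mxtrace_Mop //.
have -> : pi_act 1%:M la = fun X Y => - la X Y.
  by apply/funext => X; apply/funext => Y; rewrite /pi_act !mul1mx subrr sub0r.
rewrite dot_bracketC dot_bracketNr dot_bracketC -dot_bracketNr.
by rewrite [in RHS]dot_bracketC; congr (_ * (_ * dot_bracket _ _));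
  apply/funext => X; apply/funext => Y; rewrite /delta opprK.
Qed.

End Bilinear.

(** * Block decomposition of g = k + p and symmetry of the Ricci operator *)

Section Decomposition.
Context {R : realType} {q n : nat}.
Variable mu : bracket R (q + n).
Implicit Types (X Y : 'cV[R]_n) (Z W : 'cV[R]_q) (V : 'cV[R]_(q + n)).

Lemma in_kD a Z W : @in_k R q n (a *: Z + W) = a *: in_k n Z + in_k n W.
Proof. by rewrite /in_k scale_col_mx add_col_mx scaler0 addr0. Qed.

Lemma in_pD a X Y : @in_p R q n (a *: X + Y) = a *: in_p q X + in_p q Y.
Proof. by rewrite /in_p scale_col_mx add_col_mx scaler0 addr0. Qed.

Lemma in_kp_submx V : V = in_k n (usubmx V) + in_p q (dsubmx V).
Proof. by rewrite /in_k /in_p add_col_mx addr0 add0r vsubmxK. Qed.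

Lemma mulmx_in_k (A : 'M[R]_(q + n)) Z :
  A *m in_k n Z = col_mx (ulsubmx A *m Z) (dlsubmx A *m Z).
Proof. by rewrite -{1}[A]submxK mul_block_col !mulmx0 !addr0. Qed.

Lemma mulmx_in_p (A : 'M[R]_(q + n)) X :
  A *m in_p q X = col_mx (ursubmx A *m X) (drsubmx A *m X).
Proof. by rewrite -{1}[A]submxK mul_block_col !mulmx0 !add0r. Qed.

Lemma block_mx_in_p (E : 'M[R]_n) X :
  block_mx 0 0 0 E *m in_p q X = in_p q (E *m X).
Proof. by rewrite mul_block_col !mul0mx !add0r. Qed.

Definition killing_p X Y : R := \tr (ad mu (in_p q X) *m ad mu (in_p q Y)).

Lemma killing_pC X Y : killing_p X Y = killing_p Y X.
Proof. exact: mxtrace_mulC. Qed.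

Hypothesis mu_skew : skew_bilinear mu.

Lemma killing_p_linear Y a X X' :
  killing_p (a *: X + X') Y = a * killing_p X Y + killing_p X' Y.
Proof.
rewrite /killing_p in_pD (adP mu_skew) mulmxDl -scalemxAl.
by rewrite mxtraceD mxtraceZ.
Qed.

Lemma killing_p_linearr Y a X X' :
  killing_p Y (a *: X + X') = a * killing_p Y X + killing_p Y X'.
Proof. by rewrite !(killing_pC Y) killing_p_linear. Qed.

Lemma dotv_Bop X Y : dotv (Bop mu *m X) Y = killing_p X Y.
Proof.
apply: dotv_op_of_form => *; first exact: killing_p_linear.
exact: killing_p_linearr.
Qed.

Lemma trmx_Bop : (Bop mu)^T = Bop mu.
Proof. by apply/matrixP => i j; rewrite !mxE mxtrace_mulC. Qed.

Lemma trmx_Ric : (Ric mu)^T = Ric mu.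
Proof.
rewrite /Ric !linearB /= linearZ /=.
by rewrite trmx_Mop trmx_Bop /Uop trmx_symm.
Qed.

End Decomposition.

(** * Algebraic identities for the mean curvature vector H of a homogeneous space *)

Section Reductive.
Context {R : realType} {q n : nat}.
Variable mu : bracket R (q + n).
Hypothesis mu_hom : homogeneous mu.
Implicit Types (X Y : 'cV[R]_n) (Z W : 'cV[R]_q) (V : 'cV[R]_(q + n)).

Local Notation mu_skew := (hom_skew_bilinear mu_hom).
Local Notation la := (proj_p mu).
Local Notation H := (Hvec la).

Lemma skew_bilinear_proj_p : skew_bilinear la.
Proof.
split=> [X a Y Y'|X Y]; rewrite /proj_p.
  by rewrite in_pD (bracketPr mu_skew) linearP.
by rewrite (bracketC mu_skew) linearN.
Qed.
Local Notation la_skew := skew_bilinear_proj_p.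

(** The Jacobi identity in adjoint form; the rest of the argument uses it only through this
    equation. *)
Lemma ad_bracket V V' :
  ad mu (mu V V') = commm (ad mu V) (ad mu V').
Proof.
apply: ad_eq => Y; rewrite mulmxBl -!mulmxA !(ad_mulmx _ _ mu_skew).
have := hom_jacobi mu_hom V V' Y => /eqP.
rewrite (bracketC mu_skew Y V) (bracketC mu_skew Y (mu V V')).
by rewrite (bracketNr mu_skew) subr_eq0 eq_sym => /eqP.
Qed.

Definition isotropy Z : 'M[R]_n := drsubmx (ad mu (in_k n Z)).

Lemma ad_in_k Z : exists A,
  ad mu (in_k n Z) = block_mx A 0 0 (isotropy Z).
Proof.
exists (ulsubmx (ad mu (in_k n Z))).
rewrite -[LHS]submxK; congr block_mx; apply: eq_mulmx_basis => j.
  have := ad_mulmx (in_k n Z) (in_p q (basisv j)) mu_skew.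
  rewrite mulmx_in_p.
  move/(congr1 usubmx); rewrite (hom_kp mu_hom) col_mxKu => ->.
  by rewrite mul0mx.
have := ad_mulmx (in_k n Z) (in_k n (basisv j)) mu_skew.
rewrite mulmx_in_k.
by move/(congr1 dsubmx); rewrite (hom_kk mu_hom) col_mxKd => ->; rewrite mul0mx.
Qed.

Lemma mu_in_kp Z X : mu (in_k n Z) (in_p q X) = in_p q (isotropy Z *m X).
Proof.
have [A eA] := ad_in_k Z; rewrite -(ad_mulmx _ _ mu_skew) eA mul_block_col.
by rewrite !mulmx0 mul0mx !add0r.
Qed.

(** The upper left block vanishes because [mu] maps p and k into p. Traces over g of a single [ad]
    thus reduce to traces over p. *)
Lemma ad_in_p X : exists a c,
  ad mu (in_p q X) = block_mx 0 a c (ad la X).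
Proof.
exists (ursubmx (ad mu (in_p q X))), (dlsubmx (ad mu (in_p q X))).
rewrite -[LHS]submxK; congr block_mx; apply: eq_mulmx_basis => j.
  have := ad_mulmx (in_p q X) (in_k n (basisv j)) mu_skew.
  rewrite (bracketC mu_skew) mu_in_kp mulmx_in_k.
  move/(congr1 usubmx); rewrite linearN /= !col_mxKu oppr0 => ->.
  by rewrite mul0mx.
have := ad_mulmx (in_p q X) (in_p q (basisv j)) mu_skew.
rewrite mulmx_in_p.
move/(congr1 dsubmx); rewrite col_mxKd => ->.
by rewrite (ad_mulmx _ _ skew_bilinear_proj_p).
Qed.

Lemma trmx_isotropy Z : (isotropy Z)^T = - isotropy Z.
Proof. exact: (hom_skew mu_hom). Qed.

Lemma isotropyP a Z W : isotropy (a *: Z + W) = a *: isotropy Z + isotropy W.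
Proof.
by rewrite /isotropy in_kD (adP mu_skew); apply/matrixP => i j; rewrite !mxE.
Qed.

Lemma isotropy_inj Z : isotropy Z = 0 -> Z = 0.
Proof.
move=> Z0; apply: (hom_effective mu_hom) => X.
by rewrite mu_in_kp Z0 mul0mx /in_p col_mx0.
Qed.

(* The isotropy algebra is unimodular, because ad Z on it is skew for the
   inner product [dotm (isotropy Z) (isotropy W)], whose Gram matrix is G. *)
Lemma mxtrace_ad_in_k Z : \tr (ad mu (in_k n Z)) = 0.
Proof.
have [A eA] := ad_in_k Z; rewrite eA mxtrace_block.
have tr_skew m (C : 'M[R]_m) : \tr C = - \tr C -> \tr C = 0.
  by move/eqP; rewrite -subr_eq0 opprK -mulr2n mulrn_eq0 /= => /eqP.
have -> : \tr (isotropy Z) = 0.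
  by apply: tr_skew; rewrite -{1}mxtrace_tr trmx_isotropy mxtraceN.
rewrite addr0.
pose g W W' := dotm (isotropy W) (isotropy W').
have gE W W' : g W W' = - \tr (isotropy W *m isotropy W').
  by rewrite /g /dotm trmx_isotropy mulmxN mxtraceN.
have gC W W' : g W W' = g W' W.
  by rewrite !gE mxtrace_mulC.
have glinl (V : 'cV_q) a W W' : g (a *: W + W') V = a * g W V + g W' V.
  by rewrite /g /dotm isotropyP mulmxDl -scalemxAl mxtraceD mxtraceZ.
have glinr (V : 'cV_q) a W W' : g V (a *: W + W') = a * g V W + g V W'.
  by rewrite !(gC V) glinl.
(* The isotropy map is a representation: compare lower right blocks in [ad_bracket]. *)
have isoA W : isotropy (A *m W) = commm (isotropy Z) (isotropy W).
  have eW : in_k n (A *m W) = mu (in_k n Z) (in_k n W).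
    rewrite -(ad_mulmx _ _ mu_skew) eA mul_block_col.
    by rewrite !mulmx0 mul0mx !addr0.
  have [C eC] := ad_in_k W.
  rewrite {1}/isotropy eW ad_bracket /commm eA eC !mulmx_block.
  by rewrite !mulmx0 !mul0mx !add0r opp_block_mx add_block_mx block_mxKdr.
have gA W W' : g (A *m W) W' = - g W (A *m W').
  rewrite !gE !isoA mulmxBl mulmxBr !mxtraceB !mulmxA.
  by rewrite [\tr (_ *m isotropy Z)]mxtrace_mulC mulmxA; ring.
pose G := op_of_form g.
have Gt : G^T = G by apply/matrixP => i j; rewrite !mxE gC.
have GA : G *m A = - (A^T *m G).
  apply/matrixP => i j.
  have e W W' : dotv (G *m W) W' = g W W' by exact: dotv_op_of_form.
  rewrite [RHS]mxE -[LHS](_ : g (A *m basisv j) (basisv i) = _); last first.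
    by rewrite -e mulmxA mulmx_basis dotv_basis [LHS]mxE.
  rewrite gA -e; congr (- _).
  by rewrite dotvC dotv_mulmxl dotvC mulmxA mulmx_basis dotv_basis [LHS]mxE.
(* A kernel vector [w] satisfies [g w w = 0], so its isotropy matrix vanishes, and effectiveness
   forces [w = 0]. *)
have Gunit : G \in unitmx.
  rewrite -row_free_unit -kermx_eq0; apply/eqP/row_matrixP => i.
  rewrite row0; apply: trmx_inj; rewrite trmx0; set w := (row _ _)^T.
  have wG : G *m w = 0.
    apply: trmx_inj; rewrite trmx_mul trmxK Gt trmx0 -row_mul mulmx_ker.
    exact: row0.
  apply: isotropy_inj; apply: dotm_eq0.
  by rewrite -/(g w w) -dotv_op_of_form // -/G wG dotv0.
(* By [GA], [A] is conjugate under [G] to [- A^T], hence its trace equals its own opposite. *)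
apply: tr_skew; rewrite -{1}(mulKmx Gunit A) GA mulmxN mxtraceN.
by rewrite mulmxA mxtrace_mulC mulmxA mulmxV // mul1mx mxtrace_tr.
Qed.

Lemma mxtrace_ad_in_p X : \tr (ad mu (in_p q X)) = dotv H X.
Proof.
have [a [c ->]] := ad_in_p X.
by rewrite mxtrace_block linear0 add0r (dotv_Hvec la_skew).
Qed.

Lemma mxtrace_ad_bracket V V' : \tr (ad mu (mu V V')) = 0.
Proof. by rewrite ad_bracket mxtrace_commm. Qed.

(** The trace of [ad mu] on a bracket is zero, and the k-component of the bracket contributes
    nothing to it by [mxtrace_ad_in_k]. *)
Lemma dotv_Hvec_bracket X Y : dotv H (la X Y) = 0.
Proof.
have := mxtrace_ad_bracket (in_p q X) (in_p q Y).
rewrite [mu _ _]in_kp_submx (adD mu_skew) mxtraceD mxtrace_ad_in_k add0r.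
by rewrite mxtrace_ad_in_p.
Qed.

Lemma isotropy_Hvec Z : isotropy Z *m H = 0.
Proof.
apply: dotv_eq0 => X; rewrite dotv_mulmxl trmx_isotropy mulNmx dotvNr.
by rewrite -mxtrace_ad_in_p -mu_in_kp mxtrace_ad_bracket oppr0.
Qed.

(** The lower left block records the bracket of H with k, which is zero by [isotropy_Hvec]. *)
Lemma ad_Hvec : exists a,
  ad mu (in_p q H) = block_mx 0 a 0 (ad la H).
Proof.
have [a [c e]] := ad_in_p H; exists a; rewrite e; congr block_mx.
apply: eq_mulmx_basis => j.
have := ad_mulmx (in_p q H) (in_k n (basisv j)) mu_skew.
rewrite (bracketC mu_skew) mu_in_kp isotropy_Hvec e mul_block_col.
rewrite !mulmx0 !addr0.
move/(congr1 dsubmx); rewrite linearN /= !col_mxKd oppr0 => ->.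
by rewrite mul0mx.
Qed.

Lemma mxtrace_Bop_ad_Hvec (a : 'M[R]_(q, n)) :
  ad mu (in_p q H) = block_mx 0 a 0 (ad la H) ->
  \tr (Bop mu *m ad la H)
  = - \sum_i \tr (isotropy (a *m basisv i) *m ad la (basisv i)).
Proof.
move=> e; rewrite mxtrace_op_of_form; last 2 first.
- by move=> *; exact: (killing_p_linear mu_skew).
- by move=> *; exact: (killing_p_linearr mu_skew).
rewrite -sumrN; apply: eq_bigr => i _.
(* Trade [ad la H] for the full bracket with H, minus its k-component. The [ad] of the full bracket
   is a commutator, and its product with [ad mu (in_p q (basisv i))] is traceless by
   [mxtrace_commm_mul]; only the k-component survives. *)
have -> : in_p q (ad la H *m basisv i)
    = mu (in_p q H) (in_p q (basisv i)) - in_k n (a *m basisv i).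
  rewrite -(ad_mulmx _ _ mu_skew) e mul_block_col !mulmx0 !add0r.
  by rewrite /in_k opp_col_mx add_col_mx subrr oppr0 addr0.
rewrite (adD mu_skew) -scaleN1r (adZ mu_skew) mulmxDl mxtraceD ad_bracket.
rewrite mxtrace_commm_mul add0r scaleN1r mulNmx mxtraceN; congr (- _).
have [A ->] := ad_in_k (a *m basisv i).
have [a' [c' ->]] := ad_in_p (basisv i).
by rewrite mulmx_block mxtrace_block !mulmx0 !mul0mx !add0r linear0 add0r.
Qed.

(** If [ad la H] were a derivation of [la], the trace would vanish by [mxtrace_Mop]. The defect
    [pi_ad] comes from the k-component [a] of [ad mu (in_p q H)], acting on p through the isotropy
    representation. *)
Lemma mxtrace_Mop_ad_Hvec (a : 'M[R]_(q, n)) :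
  ad mu (in_p q H) = block_mx 0 a 0 (ad la H) ->
  \tr (Mop la *m ad la H)
  = - 2^-1 * \sum_i \tr (isotropy (a *m basisv i) *m ad la (basisv i)).
Proof.
have las := la_skew.
move=> e.
have eH X : mu (in_p q H) (in_p q X) = in_k n (a *m X) + in_p q (ad la H *m X).
  rewrite -(ad_mulmx _ _ mu_skew) e mul_block_col !mulmx0 !add0r.
  by rewrite /in_k /in_p add_col_mx add0r addr0.
have eD V : dsubmx (ad mu (in_p q H) *m V) = ad la H *m dsubmx V.
  by rewrite e -{1}[V]vsubmxK mul_block_col col_mxKd mul0mx add0r.
have dmu Z X Y : dsubmx (mu (in_k n Z + in_p q X) (in_p q Y))
    = isotropy Z *m Y + la X Y.
  by rewrite (bracketDl mu_skew) linearD /= mu_in_kp col_mxKd.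
(* The p-component of the Jacobi identity for H, [X] and [Y]. *)
have pi_ad X Y : pi_act (ad la H) la X Y
    = isotropy (a *m X) *m Y - isotropy (a *m Y) *m X.
  have /(congr1 dsubmx) :=
    ad_mulmx (mu (in_p q H) (in_p q X)) (in_p q Y) mu_skew.
  rewrite ad_bracket mulmxBl -!mulmxA linearB /= eD.
  rewrite (ad_mulmx _ (in_p q Y) mu_skew) (ad_mulmx _ (ad _ _ *m _) mu_skew).
  rewrite !(ad_mulmx _ (in_p q _) mu_skew) !eH.
  rewrite (bracketC mu_skew (in_p q X) (in_k n _ + _)) [dsubmx (- _)]linearN /=.
  rewrite !dmu opprK.
  rewrite -/(proj_p mu X Y) /pi_act (bracketC la_skew X (_ *m Y)) opprK.
  move: (ad la H *m la X Y) (isotropy (a *m X) *m Y) (isotropy (a *m Y) *m X).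
  move: (la (ad la H *m X) Y) (la (ad la H *m Y) X) => T S L P Q eL.
  have -> : L = P + T - (Q + S) by rewrite -eL addrK.
  by apply/matrixP => i j; rewrite !mxE; ring.
rewrite mxtrace_Mop //.
set T := \sum_i _.
(* Each of the two terms of [pi_ad] contributes [- T]: the sign is the skewness of the isotropy
   matrices, and the terms agree after exchanging the indices. *)
suff -> : dot_bracket (pi_act (ad la H) la) la = - T - T by field.
pose S i j :=
  dotv (isotropy (a *m basisv i) *m basisv j) (la (basisv i) (basisv j)).
have TE : - T = \sum_i \sum_j S i j.
  rewrite -sumrN; apply: eq_bigr => i _.
  rewrite -[RHS](_ : \sum_j dotv (isotropy (a *m basisv i) *m basisv j)
      (ad la (basisv i) *m basisv j) = _); last first.
    by apply: eq_bigr => j _; rewrite ad_mulmx.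
  by rewrite sum_dotv_mulmx trmx_isotropy mulNmx mxtraceN.
rewrite {2}TE exchange_big TE -big_split; apply: eq_bigr => i _.
rewrite -big_split; apply: eq_bigr => j _ /=; rewrite pi_ad dotvBl.
by rewrite /S (bracketC la_skew (basisv j)) dotvNr.
Qed.

(** The U term drops out because [la H H] is orthogonal to H. In the M term the second sum vanishes,
    H being orthogonal to all brackets, and the B term is the trace of the square of [ad la H] by
    the block form of [ad_Hvec]. Together they form [- \tr (Uop mu *m Uop mu)]. *)
Lemma dotv_Ric_Hvec :
  dotv (Ric mu *m H) H = - \tr (Uop mu *m Uop mu).
Proof.
have las := la_skew.
have bHH : dotv (ad la H *m H) H = 0.
  by rewrite ad_mulmx // dotvC dotv_Hvec_bracket.
have UH : dotv (Uop mu *m H) H = 0.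
  rewrite -scalemxAl mulmxDl dotvZl dotvDl bHH.
  by rewrite dotv_mulmxl trmxK dotvC bHH addr0 mulr0.
have UU : \tr (Uop mu *m Uop mu)
    = 2^-1 * (\tr (ad la H *m ad la H) + \tr ((ad la H)^T *m ad la H)).
  rewrite {2}/Uop tr_mul_symm ?trmx_symm //.
  by rewrite -scalemxAl mulmxDl mxtraceZ mxtraceD.
have MH : dotv (Mop la *m H) H = - 2^-1 * \tr ((ad la H)^T *m ad la H).
  rewrite dotv_Mop // /Mpolar [X in _ + _ * X]big1 ?mulr0 ?addr0; last first.
    move=> i _; rewrite big1 // => j _.
    by rewrite [dotv _ H]dotvC dotv_Hvec_bracket mul0r.
  congr (_ * _); rewrite -sum_dotv_mulmx; apply: eq_bigr => i _.
  by rewrite ad_mulmx // -dotv_parseval.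
have BH : dotv (Bop mu *m H) H = \tr (ad la H *m ad la H).
  have [a e] := ad_Hvec.
  rewrite (dotv_Bop mu_skew) /killing_p e mulmx_block mxtrace_block.
  by rewrite !mulmx0 mul0mx !add0r linear0 add0r.
rewrite /Ric !mulmxBl -scalemxAl !dotvBl dotvZl MH BH UH UU.
by field.
Qed.

(** As [Ric mu] is symmetric, [Uop mu] may be replaced by [ad la H]; the contributions of M and of
    half of B then cancel. *)
Lemma mxtrace_Ric_Uop :
  \tr (Ric mu *m Uop mu) = - \tr (Uop mu *m Uop mu).
Proof.
have las := la_skew.
have [a e] := ad_Hvec.
have Ut : (Uop mu)^T = Uop mu by rewrite trmx_symm.
rewrite {1}/Uop tr_mul_symm ?trmx_Ric // /Ric !mulmxBl -scalemxAl.
rewrite !mxtraceB mxtraceZ (mxtrace_Mop_ad_Hvec e) (mxtrace_Bop_ad_Hvec e).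
rewrite {3}/Uop tr_mul_symm //.
by field.
Qed.

End Reductive.

(** * Derivatives of the tensors attached to a curve of brackets *)

Section BracketCurve.
Context {R : realType} {n : nat}.
Variables (la : R -> bracket R n) (t : R) (dla : bracket R n).
Hypothesis la_derive : forall X Y, is_derive t 1 (fun s => la s X Y) (dla X Y).

Lemma is_derive_ad X : is_derive t 1 (fun s => ad (la s) X) (ad dla X).
Proof.
apply/is_derive_mxP => i j; rewrite mxE.
under [fun s => _]eq_fun do rewrite mxE.
exact: (iffLR (is_derive_mxP _ _ _)).
Qed.

Lemma is_derive_Hvec : is_derive t 1 (fun s => Hvec (la s)) (Hvec dla).
Proof.
apply/is_derive_mxP => i j; rewrite mxE.
under [fun s => _]eq_fun do rewrite mxE.
by apply: is_derive_tr; exact: is_derive_ad.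
Qed.

Lemma is_derive_ad_Hvec :
  (\forall s \near t, skew_bilinear (la s)) -> skew_bilinear dla ->
  is_derive t 1 (fun s => ad (la s) (Hvec (la s)))
    (ad dla (Hvec (la t)) + ad (la t) (Hvec dla)).
Proof.
move=> las dlas; have la_t := nbhs_singleton las.
(* [ad_sum] needs skew-bilinearity, known only near [t], so the curve is replaced by one agreeing
   with it there. Scalar matrices let [is_derive_mulmx] act as the product rule for a scalar times a
   matrix. *)
pose F s := \sum_i (Hvec (la s) i 0)%:M *m ad (la s) (basisv i).
apply: (@near_eq_is_derive _ _ _ F).
  near=> s; rewrite [RHS]ad_sum; last by near: s.
  by apply: eq_bigr => i _; rewrite mul_scalar_mx.
rewrite (ad_sum dlas) (ad_sum la_t) addrC -big_split /=.
apply: is_derive_bigsum => i; rewrite -!mul_scalar_mx.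
apply: is_derive_mulmx; last exact: is_derive_ad.
apply/is_derive_mxP => k l; rewrite mxE.
under [fun s => _]eq_fun do rewrite mxE.
have /is_derive_mxP/(_ i 0) := is_derive_Hvec.
case: (k == l) => // _; exact: is_derive_cst.
Unshelve. all: by end_near. Qed.

(** M is quadratic in the bracket, so differentiating gives the polar form in both orders; by
    [op_of_MpolarC] the second is the transpose of the first. *)
Lemma is_derive_Mop : is_derive t 1 (fun s => Mop (la s))
  (op_of_form (Mpolar (la t) dla) + (op_of_form (Mpolar (la t) dla))^T).
Proof.
have lad k i j : is_derive t 1
    (fun s => dotv (la s (basisv k) (basisv i)) (basisv j))
    (dotv (dla (basisv k) (basisv i)) (basisv j)).
  rewrite dotv_basis; under [fun s => _]eq_fun do rewrite dotv_basis.
  exact: (iffLR (is_derive_mxP _ _ _)).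
apply/is_derive_mxP => i j; rewrite -op_of_MpolarC !mxE.
under [fun s => _]eq_fun do rewrite mxE.
rewrite /Mpolar addrACA -!mulrDr -!big_split /=.
apply: is_derive_add; apply: is_derive_scale; apply: is_derive_bigsum => k;
  rewrite -big_split; apply: is_derive_bigsum => l /=.
  by rewrite addrC; exact: is_derive_mul.
exact: is_derive_mul.
Qed.

Lemma is_derive_dot_bracket :
  is_derive t 1 (fun s => dot_bracket (la s) (la s))
    (2 * dot_bracket dla (la t)).
Proof.
have -> : 2 * dot_bracket dla (la t)
    = dot_bracket dla (la t) + dot_bracket (la t) dla.
  by rewrite (dot_bracketC (la t)); ring.
rewrite -big_split; apply: is_derive_bigsum => i.
rewrite -big_split; apply: is_derive_bigsum => j.
exact: is_derive_dotv.
Qed.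

End BracketCurve.

(** * Infinitesimal variations in the direction of a matrix acting on p *)

Section Flow.
Context {R : realType}.

(** Scalars act on brackets with weight -1, one output against two inputs; this is where the terms
    in [r] originate. *)
Lemma delta_scalar n (la : bracket R n) E a X Y : skew_bilinear la ->
  delta la (E + a%:M) X Y = a *: la X Y + delta la E X Y.
Proof.
move=> las; rewrite /delta /pi_act !mulmxDl !mul_scalar_mx (bracketDl las).
rewrite (bracketDr las) (bracketZl las) (bracketZr las).
by apply/matrixP => i j; rewrite !mxE; ring.
Qed.

(** With P the polar matrix of [delta la E], the left side without its scalar part is twice the
    symmetric part of P, while [Delta la E] is -4 times it by [delta_trE]. *)
Lemma op_of_Mpolar_delta n (la : bracket R n) E a : skew_bilinear la ->
  op_of_form (Mpolar la (delta la (E + a%:M)))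
    + (op_of_form (Mpolar la (delta la (E + a%:M))))^T
  = - 2^-1 *: Delta la E + (2 * a) *: Mop la.
Proof.
move=> las; have dlas := skew_bilinear_delta las E.
have eM : op_of_form (Mpolar la (delta la (E + a%:M)))
    = a *: Mop la + op_of_form (Mpolar la (delta la E)).
  apply/matrixP => i j; rewrite !mxE.
  rewrite -[Mform _ _ _]/(Mpolar la la _ _) /Mpolar mulrDr addrACA.
  rewrite !(mulrCA a) -!mulrDr.
  congr (_ * _ + _ * _); rewrite mulr_sumr -big_split; apply: eq_bigr => k _;
    rewrite mulr_sumr -big_split; apply: eq_bigr => l _ /=;
    rewrite delta_scalar // dotv_linear; ring.
rewrite eM linearD /= linearZ /= trmx_Mop /Delta delta_trE // symmZ symm_trmx.
rewrite /symm; move: (op_of_form _) => C.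
by apply/matrixP => i j; rewrite !mxE; field.
Qed.

Variables (q n : nat).

(** The block matrix annihilates k and preserves p, so the p-component on p evolves by itself,
    without reference to the rest of [mu]. *)
Lemma is_derive_proj_p (mu : R -> bracket R (q + n)) (t : R) E :
  (forall X Y, is_derive t 1 (fun s => mu s X Y)
                 (delta (mu t) (block_mx 0 0 0 E) X Y)) ->
  forall X Y, is_derive t 1 (fun s => proj_p (mu s) X Y)
                (delta (proj_p (mu t)) E X Y).
Proof.
move=> mud X Y.
have -> : delta (proj_p (mu t)) E X Y
    = dsubmx (delta (mu t) (block_mx 0 0 0 E) (in_p q X) (in_p q Y)).
  rewrite /delta /pi_act !block_mx_in_p linearN /= !linearB /= /proj_p.
  rewrite -[mu t (in_p q X) (in_p q Y)]vsubmxK mul_block_col !mul0mx !add0r.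
  by rewrite !col_mxKd.
apply/is_derive_mxP => i j; rewrite mxE.
under [fun s => _]eq_fun do rewrite mxE.
exact: (iffLR (is_derive_mxP _ _ _)).
Qed.

(** The commutator parts of [ad_delta] cancel by [mxtrace_commm_ad], leaving the Killing form with
    [E] applied to either argument. *)
Lemma is_derive_Bop (mu : R -> bracket R (q + n)) (t : R) E :
  skew_bilinear (mu t) ->
  (forall X Y, is_derive t 1 (fun s => mu s X Y)
                 (delta (mu t) (block_mx 0 0 0 E) X Y)) ->
  is_derive t 1 (fun s => Bop (mu s)) (Bop (mu t) *m E + E^T *m Bop (mu t)).
Proof.
move=> mus mud; apply/is_derive_mxP => i j.
under [fun s => _]eq_fun do rewrite mxE.
apply: is_derive_eq.
  by apply: is_derive_tr; apply: is_derive_mulmx; exact: is_derive_ad.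
rewrite !ad_delta // !block_mx_in_p mulmxDl mulmxDr !mxtraceD addrACA.
rewrite mxtrace_commm_ad add0r -!/(killing_p _ _ _) -!dotv_Bop //.
rewrite -[X in dotv _ (X *m _)]trmxK -[X in _ + X]dotv_mulmxl.
rewrite !mulmxA !mulmx_basis !dotv_basis [RHS]mxE.
by congr (_ + _); rewrite [LHS]mxE.
Qed.

End Flow.

(** * The evolution equations along the normalized flow *)

Theorem proposition3p11 (R : realType) (q n : nat) (J : set R) (r : R -> R)
    (mu0 : bracket R (q + n)) (mu : R -> bracket R (q + n))
    (J_open : open J) (J_interval : is_interval J) (J0 : J 0)
    (r_continuous : {within J, continuous r})
    (mu0_hom : homogeneous mu0)
    (mu_hom : forall t, J t -> homogeneous (mu t))
    (mu_init : mu 0 = mu0)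
    (mu_flow : normalized_bracket_flow J r mu)
    (t : R) (Jt : J t) :
  let la := proj_p (mu t) in
  let rt := r t in
  let Rc := Ric (mu t) in
  let M := Mop la in
  let B := Bop (mu t) in
  let H := Hvec la in
  let sc := \tr Rc in
  (is_derive t 1 (fun s => Ric (mu s))
     (- 2^-1 *: Delta la Rc - 2^-1 *: (B *m Rc + Rc *m B)
      - 2 *: symm (ad la (Rc *m H)) - symm (commm (ad la H) Rc)
      + (2 * rt) *: Rc)) /\
  (is_derive t 1 (fun s => Mop (proj_p (mu s)))
     (- 2^-1 *: Delta la Rc + (2 * rt) *: M)) /\
  (is_derive t 1 (fun s => Bop (mu s))
     (B *m Rc + Rc *m B + (2 * rt) *: B)) /\
  (is_derive t 1 (fun s => Hvec (proj_p (mu s)))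
     (Rc *m H + rt *: H)) /\
  (is_derive t 1 (fun s => Uop (mu s))
     (2 *: symm (ad la (Rc *m H)) + symm (commm (ad la H) Rc)
      + (2 * rt) *: symm (ad la H))) /\
  (is_derive t 1 (fun s => \tr (Ric (mu s)))
     (2 * \tr (Rc *m Rc) + 2 * rt * sc) /\
   2 * \tr (Rc *m Rc) + 2 * rt * sc = 2 * dotm Rc Rc + 2 * rt * sc) /\
  (is_derive t 1 (fun s => dot_bracket (proj_p (mu s)) (proj_p (mu s)))
     (- 8 * \tr (Rc *m M) + 2 * rt * dot_bracket la la)) /\
  (is_derive t 1 (fun s => \tr (Bop (mu s)))
     (2 * \tr (Rc *m B) + 2 * rt * \tr B)) /\
  (is_derive t 1 (fun s => dotv (Hvec (proj_p (mu s))) (Hvec (proj_p (mu s))))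
     (- 2 * \tr (symm (ad la H) *m symm (ad la H)) + 2 * rt * dotv H H)).
Proof.
move=> la rt Rc M B H sc.
have hom := mu_hom t Jt.
have mus := hom_skew_bilinear hom; have las := skew_bilinear_proj_p hom.
have Rct : Rc^T = Rc := trmx_Ric (mu t).
have Bt : B^T = B := trmx_Bop (mu t).
set E := Rc + rt%:M.
have Et : E^T = E by rewrite linearD /= Rct tr_scalar_mx.
have mud X Y : is_derive t 1 (fun s => mu s X Y)
    (delta (mu t) (block_mx 0 0 0 E) X Y) by exact: mu_flow.
have lad := is_derive_proj_p mud.
have dlas := skew_bilinear_delta las E.
(* Openness of [J] gives bilinearity on a whole neighbourhood of [t], as [is_derive_ad_Hvec]
   requires. *)
have near_skew : \forall s \near t, skew_bilinear (proj_p (mu s)).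
  have : \forall s \near t, J s by exact: open_nbhs_nbhs.
  by apply: filterS => s Js; exact: skew_bilinear_proj_p (mu_hom s Js).
have EH : E *m H = Rc *m H + rt *: H by rewrite mulmxDl mul_scalar_mx.
have Md : is_derive t 1 (fun s => Mop (proj_p (mu s)))
    (- 2^-1 *: Delta la Rc + (2 * rt) *: M).
  by rewrite -op_of_Mpolar_delta //; exact: is_derive_Mop.
have Bd : is_derive t 1 (fun s => Bop (mu s))
    (B *m Rc + Rc *m B + (2 * rt) *: B).
  apply: is_derive_eq; first exact: is_derive_Bop mus mud.
  rewrite Et -/B mulmxDl mulmxDr mul_scalar_mx mul_mx_scalar addrACA -scalerDl.
  by congr (_ + _ *: _); ring.
have Hd : is_derive t 1 (fun s => Hvec (proj_p (mu s))) (Rc *m H + rt *: H).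
  by rewrite -EH -{1}Et -Hvec_delta //; exact: is_derive_Hvec.
have Ud : is_derive t 1 (fun s => Uop (mu s))
    (2 *: symm (ad la (Rc *m H)) + symm (commm (ad la H) Rc)
      + (2 * rt) *: symm (ad la H)).
  apply: is_derive_eq.
    by apply: is_derive_symm; exact: is_derive_ad_Hvec lad near_skew dlas.
  rewrite Hvec_delta // ad_delta // Et -/la -/H EH adD // adZ //.
  have -> : commm (ad la H) E = commm (ad la H) Rc.
    rewrite /commm mulmxDl mulmxDr mul_scalar_mx mul_mx_scalar.
    by rewrite opprD addrACA subrr addr0.
  rewrite !symmD !symmZ.
  move: (symm _) (symm _) (symm _) => P Q S.
  by apply/matrixP => i j; rewrite !mxE; ring.
have Rcd : is_derive t 1 (fun s => Ric (mu s))
     (- 2^-1 *: Delta la Rc - 2^-1 *: (B *m Rc + Rc *m B)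
      - 2 *: symm (ad la (Rc *m H)) - symm (commm (ad la H) Rc)
      + (2 * rt) *: Rc).
  have MBd := is_derive_sub Md (is_derive_scale 2^-1 Bd).
  apply: (is_derive_eq (is_derive_sub MBd Ud)).
  (* Only the scaling term is unfolded, so that the pieces from M, B and U recombine into [Ric]
     there and [Rc] stays opaque elsewhere. *)
  have -> : (2 * rt) *: Rc = (2 * rt) *: (M - 2^-1 *: B - symm (ad la H)) by [].
  move: (M) (B) (Delta _ _) (B *m Rc + Rc *m B) (symm (ad la (Rc *m H))).
  move: (symm (ad la H)) (symm (commm _ _)) => P Q M' B' D C S.
  by apply/matrixP => i j; rewrite !mxE; field.
have tr_adRH : \tr (ad la (Rc *m H)) = - \tr (Uop (mu t) *m Uop (mu t)).
  by rewrite -dotv_Hvec // dotvC (dotv_Ric_Hvec hom).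
split; first exact: Rcd.
split; first exact: Md.
split; first exact: Bd.
split; first exact: Hd.
split; first exact: Ud.
split.
  split; last by rewrite /dotm Rct.
  apply: (is_derive_eq (is_derive_tr Rcd)).
  rewrite mxtraceD 3!mxtraceB (mxtraceZ _ (Delta _ _)) mxtrace_Delta //.
  rewrite (mxtraceZ _ (symm _)) !tr_symm mxtrace_commm tr_adRH.
  rewrite (mxtraceZ _ (_ + _)) (mxtraceD (B *m Rc)) (mxtraceZ _ Rc).
  (* Expand one factor [Rc] only; the U term changes sign by [mxtrace_Ric_Uop]. Twice this
     expression is the trace of (i) apart from the scaling term. *)
  have RcRc : \tr (Rc *m Rc) = \tr (M *m Rc) - 2^-1 * \tr (B *m Rc)
      + \tr (Uop (mu t) *m Uop (mu t)).
    rewrite -[\tr (Uop _ *m _)]opprK -(mxtrace_Ric_Uop hom) -/Rc.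
    rewrite (mxtrace_mulC Rc (Uop _)).
    by rewrite {1}/Rc /Ric !mulmxBl -scalemxAl !mxtraceB mxtraceZ.
  by rewrite RcRc (mxtrace_mulC Rc B) -/sc; field.
split.
  have := is_derive_dot_bracket (la := fun s => proj_p (mu s)) lad.
  move/is_derive_eq; apply.
  have -> : delta (proj_p (mu t)) E
      = fun X Y => rt *: la X Y + delta la Rc X Y.
    by apply/funext => X; apply/funext => Y; rewrite delta_scalar.
  (* The moment map identity; the factor 2 from differentiating a square turns -4 into -8. *)
  have dR : dot_bracket (delta la Rc) la = - 4 * \tr (Rc *m M).
    rewrite (mxtrace_mulC Rc) mxtrace_Mop // dot_bracketC.
    by rewrite [dot_bracket la _]dot_bracketNr (dot_bracketC la); field.
  by rewrite dot_bracketP dR; ring.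
split.
  apply: (is_derive_eq (is_derive_tr Bd)).
  by rewrite !mxtraceD mxtraceZ (mxtrace_mulC B); ring.
apply: (is_derive_eq (is_derive_dotv Hd Hd)).
rewrite -/la -/H (dotvC H) !dotvDl !dotvZl (dotv_Ric_Hvec hom) -/(Uop (mu t)).
by ring.
Qed.
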